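(* Let $X$ be a finite set, let $\mathrm{FIM}_X$ be the free inverse monoid generated by $X$, and fix a total order on $\tilde X$. Then $\mathcal{H}\text{-}\mathrm{SL}(\mathrm{FIM}_X)=\mathrm{SL}(\mathrm{FIM}_X)$ is a context-free language.
   Context: $\tilde X=X\cup X^{-1}$ with $X^{-1}=\{x^{-1}:x\in X\}$ a disjoint copy of $X$; $\pi:\tilde X^*\to \mathrm{FIM}_X$ is the canonical surjective homomorphism. The total order on $\tilde X$ induces the ShortLex order on $\tilde X^*$: shorter words come first, and words of equal length are compared lexicographically. $\mathrm{SL}(\mathrm{FIM}_X)$ is the set of $w\in\tilde X^*$ that are ShortLex-minimal in $\{u\in\tilde X^*: u\pi=w\pi\}$. With $\mathcal{H}$ Green's relation on $\mathrm{FIM}_X$, $\mathcal{H}\text{-}\mathrm{SL}(\mathrm{FIM}_X)$ is the set of $w\in\tilde X^*$ that are ShortLex-minimal in $\{u\in\tilde X^*: (u\pi)\,\mathcal{H}\,(w\pi)\}$. *)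

(* Defs.v *)
From HB Require Import structures.
From mathcomp Require Import all_boot.
From mathcomp Require Import boolp classical_sets.

Set Implicit Arguments.
Unset Strict Implicit.
Unset Printing Implicit Defensive.

Local Open Scope classical_set_scope.
Local Open Scope quotient_scope.

(* [inl x] is the letter x and [inr x] is the letter x^{-1}. *)
Notation letter X := (X + X)%type.

Definition inv_letter (X : Type) (a : letter X) : letter X :=
  match a with inl x => inr x | inr x => inl x end.

Definition inv_word (X : Type) (u : seq (letter X)) : seq (letter X) :=
  rev (map (@inv_letter X) u).

(* The Vagner congruence: FIM_X is presented, as a monoid on the generators
   [letter X], by u u^{-1} u = u and u u^{-1} v v^{-1} = v v^{-1} u u^{-1}. *)
Inductive vagner (X : Type) : seq (letter X) -> seq (letter X) -> Prop :=
| vagner_inv u : vagner (u ++ inv_word u ++ u) u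
| vagner_comm u v :
    vagner (u ++ inv_word u ++ v ++ inv_word v)
           (v ++ inv_word v ++ u ++ inv_word u)
| vagner_refl u : vagner u u
| vagner_sym u v : vagner u v -> vagner v u
| vagner_trans u v w : vagner u v -> vagner v w -> vagner u w
| vagner_cat u u' v v' : vagner u u' -> vagner v v' -> vagner (u ++ v) (u' ++ v').

Section FreeInverseMonoid.
Variable X : choiceType.

Definition vagnerb (u v : seq (letter X)) : bool := `[< vagner u v >].

Lemma vagnerb_refl : reflexive vagnerb.
Proof. by move=> u; apply/asboolP; exact: vagner_refl. Qed.

Lemma vagnerb_sym : symmetric vagnerb.
Proof. by move=> u v; apply/asboolP/asboolP; exact: vagner_sym. Qed.

Lemma vagnerb_trans : transitive vagnerb.
Proof.
move=> v u w /asboolP uv /asboolP vw; apply/asboolP; exact: vagner_trans uv vw.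
Qed.

Canonical vagner_equiv := EquivRel vagnerb vagnerb_refl vagnerb_sym vagnerb_trans.

Definition FIM := {eq_quot vagnerb}.
HB.instance Definition _ := Choice.on FIM.

Definition fim_pi (u : seq (letter X)) : FIM := \pi_FIM u.
Definition fim_one : FIM := fim_pi [::].
Definition fim_mul (a b : FIM) : FIM := fim_pi (repr a ++ repr b).

Lemma fim_piP u v : fim_pi u = fim_pi v <-> vagner u v.
Proof. by split=> [/eqmodP/asboolP|uv] //; apply/eqmodP/asboolP. Qed.

Lemma fim_pi_surj a : exists u, fim_pi u = a.
Proof. by exists (repr a); rewrite /fim_pi reprK. Qed.

Lemma fim_piM u v : fim_pi (u ++ v) = fim_mul (fim_pi u) (fim_pi v).
Proof.
by apply/fim_piP/vagner_cat; apply/fim_piP; rewrite /fim_pi reprK.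
Qed.

Lemma fim_mulA : associative fim_mul.
Proof.
move=> a b c; case: (fim_pi_surj a) (fim_pi_surj b) (fim_pi_surj c).
by move=> u <- [v <-] [w <-]; rewrite -!fim_piM catA.
Qed.

Lemma fim_1mul : left_id fim_one fim_mul.
Proof. by move=> a; case: (fim_pi_surj a) => u <-; rewrite -fim_piM. Qed.

Lemma fim_mul1 : right_id fim_one fim_mul.
Proof. by move=> a; case: (fim_pi_surj a) => u <-; rewrite -fim_piM cats0. Qed.

HB.instance Definition _ := isMonoid.Build FIM fim_mulA fim_1mul fim_mul1.

End FreeInverseMonoid.

Section Green.
Variable M : monoidType.
Local Open Scope group_scope.

Definition greenL (a b : M) : Prop :=
  range (fun s : M => s * a) = range (fun s : M => s * b).
Definition greenR (a b : M) : Prop :=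
  range (fun s : M => a * s) = range (fun s : M => b * s).
Definition greenH (a b : M) : Prop := greenL a b /\ greenR a b.

End Green.

Section ShortLex.
Variables (A : eqType) (le : rel A).

Definition total_order : Prop :=
  [/\ reflexive le, antisymmetric le, transitive le & total le].

Fixpoint lexle (u v : seq A) : bool :=
  match u, v with
  | [::], _ => true
  | _ :: _, [::] => false
  | a :: u', b :: v' => if a == b then lexle u' v' else le a b
  end.

Definition shortlex (u v : seq A) : bool :=
  (size u < size v) || (size u == size v) && lexle u v.

Definition shortlex_minimal (S : set (seq A)) (w : seq A) : Prop :=
  S w /\ forall u, S u -> shortlex u w -> u = w.

End ShortLex.

Definition SL_FIM (X : choiceType) (le : rel (letter X)) :
    set (seq (letter X)) :=
  [set w | shortlex_minimal le [set u | fim_pi u = fim_pi w] w].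

Definition H_SL_FIM (X : choiceType) (le : rel (letter X)) :
    set (seq (letter X)) :=
  [set w | shortlex_minimal le [set u | greenH (fim_pi u) (fim_pi w)] w].

(* Context-free grammars over the terminal alphabet A; in a sentential form,
   [inl] marks nonterminals and [inr] marks terminals. *)
Record cfg (A : eqType) : Type := CFG {
  nonterm : finType;
  start : nonterm;
  rules : seq (nonterm * seq (nonterm + A))
}.

Inductive derives (A : eqType) (G : cfg A) :
    seq (nonterm G + A) -> seq (nonterm G + A) -> Prop :=
| derives_refl s : derives s s
| derives_step s l N rhs r :
    (N, rhs) \in rules G ->
    derives s (l ++ inl N :: r) ->
    derives s (l ++ rhs ++ r).

Definition cfg_language (A : eqType) (G : cfg A) : set (seq A) :=
  [set w | derives [:: inl (start G)] (map inr w)].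

Definition context_free (A : eqType) (L : set (seq A)) : Prop :=
  exists G : cfg A, cfg_language G = L.

(* Main.v *)
Require Import Defs.
From mathcomp Require Import all_boot.
From mathcomp Require Import boolp classical_sets.
From mathcomp Require Import fintype finset zify.

Set Implicit Arguments.
Unset Strict Implicit.
Unset Printing Implicit Defensive.

(** A word over X and its inverses is a walk from the root in the Cayley tree
    of the free group.  The reduced form of its endpoint ([run]) and the set of
    vertices it meets ([visits], the Munn tree) depend only on its image in the
    free inverse monoid, because they are preserved by the two Vagner
    relations ([vagner_run_visits]).

    The shortest walk covering a finite subtree T and ending at r follows the
    geodesic from the root to r, and makes at each vertex of the geodesic a
    depth-first excursion into the branches hanging there, so that geodesic
    edges are crossed once and all other edges twice.  Among these walks the
    lexicographically least one explores the branches at each vertex in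
    increasing order.  The predicates [tour] (an excursion returning to its
    start) and [walk] (excursions strung along a reduced path) describe exactly
    these words, and they are the productions of a context-free grammar: the
    only memory needed is the set of letters still allowed at the current
    vertex, of which there are finitely many.

    That the walks are the shortlex normal forms follows from two facts.
    Every word is equivalent to a walk that is no larger in shortlex
    ([ex_normal_form]): one letter at a time, a walk followed by a letter is
    turned back into a walk by letting idempotents commute ([tour_insert] and
    [tour_extract]).  Two walks with the same endpoint and the same vertices
    are equal ([walk_inj]).  Together they also give Munn's theorem ([munn]):
    endpoint and vertices determine the element.

    It remains to see that H-related elements are equal ([greenH_trivial]).
    R-related words have the same tree T.  If moreover u = t v with u, v
    R-related, then left translation by the group element g of t maps T into
    itself; since T contains the root, it contains all powers of g, which
    therefore have bounded length.  The free group being torsion-free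
    ([run_torsion_free]), g = 1, so u and v also have the same endpoint. *)

(** * The shortlex order *)

Section ShortLexTheory.
Variables (A : eqType) (le : rel A).
Implicit Types u v w : seq A.

Lemma lexle_refl u : lexle le u u.
Proof. by elim: u => //= a u ->; rewrite eqxx. Qed.

Lemma shortlex_refl u : shortlex le u u.
Proof. by rewrite /shortlex eqxx lexle_refl orbT. Qed.

Lemma shortlex_of_size u v : size u < size v -> shortlex le u v.
Proof. by rewrite /shortlex => ->. Qed.

Lemma lexle_catl w u v : lexle le (w ++ u) (w ++ v) = lexle le u v.
Proof. by elim: w => //= a w ->; rewrite eqxx. Qed.

Lemma shortlex_catl w u v : shortlex le (w ++ u) (w ++ v) = shortlex le u v.
Proof. by rewrite /shortlex !size_cat ltn_add2l eqn_add2l lexle_catl. Qed.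

Lemma shortlex_cons a u v : shortlex le (a :: u) (a :: v) = shortlex le u v.
Proof. exact: (shortlex_catl [:: a]). Qed.

Lemma lexle_catr w u v :
  size u = size v -> lexle le u v -> lexle le (u ++ w) (v ++ w).
Proof.
elim: u v => [|a u IHu] [|b v] //= => [_ _|[suv]]; first exact: lexle_refl.
by case: ifP => // _; exact: IHu.
Qed.

Lemma shortlex_catr w u v :
  shortlex le u v -> shortlex le (u ++ w) (v ++ w).
Proof.
rewrite /shortlex !size_cat ltn_add2r eqn_add2r.
case/orP=> [->//|/andP[/eqP suv luv]].
by rewrite suv eqxx lexle_catr // orbT.
Qed.

Hypothesis hle : total_order le.

Lemma lexle_trans u v w : lexle le u v -> lexle le v w -> lexle le u w.
Proof.
have [_ anti trans _] := hle.
elim: u v w => // a u IHu [|b v] [|c w] //=.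
have [<-|ab] := eqVneq a b; first by case: eqP => // _; exact: IHu.
have [<-|bc] := eqVneq b c; first by rewrite (negPf ab).
move=> le_ab le_bc; case: eqP => [ac|_]; last exact: trans le_ab le_bc.
by case/eqP: ab; apply: anti; rewrite le_ab ac.
Qed.

Lemma lexle_anti u v : lexle le u v -> lexle le v u -> u = v.
Proof.
have [_ anti _ _] := hle.
elim: u v => [|a u IHu] [|b v] //=; rewrite eq_sym.
case: eqP => [->|ba] luv lvu; first by rewrite (IHu v).
by case: ba; apply: anti; rewrite lvu luv.
Qed.

Lemma shortlex_trans u v w :
  shortlex le u v -> shortlex le v w -> shortlex le u w.
Proof.
rewrite /shortlex; case/orP=> [suv|/andP[/eqP-> luv]].
  by case/orP=> [/(ltn_trans suv)->//|/andP[/eqP<- _]]; rewrite suv.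
case/orP=> [->//|/andP[-> lvw]]; by rewrite (lexle_trans luv lvw) orbT.
Qed.

Lemma shortlex_anti u v : shortlex le u v -> shortlex le v u -> u = v.
Proof.
rewrite /shortlex; case/orP=> [suv|/andP[/eqP suv luv]].
  by case/orP=> [/(ltn_trans suv)|/andP[/eqP svu]]; rewrite ?svu ltnn // in suv *.
by rewrite suv ltnn eqxx; exact: lexle_anti.
Qed.

End ShortLexTheory.

(** * Walks in the Cayley tree of the free group *)

Section Stacks.
Variable X : eqType.
Notation A := (letter X).
Implicit Types (a b c : A) (s t u v w x : seq A).

Lemma inv_letterK : involutive (@inv_letter X).
Proof. by case. Qed.

Lemma inv_letter_neq a : a != inv_letter a.
Proof. by case: a. Qed.

Lemma inv_word_cat u v : inv_word (u ++ v) = inv_word v ++ inv_word u.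
Proof. by rewrite /inv_word map_cat rev_cat. Qed.

Lemma inv_wordK : involutive (@inv_word X).
Proof. by move=> u; rewrite /inv_word map_rev revK mapK //; exact: inv_letterK. Qed.

Lemma inv_word_cons a u : inv_word (a :: u) = rcons (inv_word u) (inv_letter a).
Proof. by rewrite /inv_word /= rev_cons. Qed.

(** Vertices of the Cayley tree are reduced words kept as stacks, last letter
    first: crossing an edge is then an operation on the top of the stack, and
    the descendants of a vertex are the stacks having it as a suffix. *)
Definition push s a : seq A :=
  if s is b :: s' then if a == inv_letter b then s' else a :: s else [:: a].

Definition run s u : seq A := foldl push s u.
Definition visits s u : seq (seq A) := s :: scanl push s u.
Definition nocancel a b : bool := b != inv_letter a.
Definition reduced u : bool := sorted nocancel u.

Lemma nocancel_sym a b : nocancel a b = nocancel b a.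
Proof. by rewrite /nocancel eq_sym (can2_eq inv_letterK inv_letterK). Qed.

Lemma reduced_push s a : reduced s -> reduced (push s a).
Proof.
case: s => [|b s] //= hs; case: ifP => [_|/negbT ab]; first exact: path_sorted hs.
by rewrite /reduced /= hs andbT nocancel_sym.
Qed.

Lemma reduced_run s u : reduced s -> reduced (run s u).
Proof. by elim: u s => //= a u IHu s hs; apply/IHu/reduced_push. Qed.

Lemma pushK s a : reduced s -> push (push s a) (inv_letter a) = s.
Proof.
case: s => [|b s] /=; first by rewrite eqxx.
case: eqP => [->|_ _]; last by rewrite /= eqxx.
by rewrite inv_letterK; case: s => //= c s /andP[bc _]; rewrite ifN // -/(nocancel c b) nocancel_sym.
Qed.

Lemma run_cons s a u : run s (a :: u) = run (push s a) u.
Proof. by []. Qed.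

Lemma run_cat s u v : run s (u ++ v) = run (run s u) v.
Proof. exact: foldl_cat. Qed.

Lemma run_rcons s u a : run s (rcons u a) = push (run s u) a.
Proof. exact: foldl_rcons. Qed.

Lemma run_inv s u : reduced s -> run (run s u) (inv_word u) = s.
Proof.
elim: u s => //= a u IHu s hs.
by rewrite inv_word_cons run_rcons IHu ?reduced_push // pushK.
Qed.

Lemma mem_visits_start s u : s \in visits s u.
Proof. exact: mem_head. Qed.

Lemma mem_visits_end s u : run s u \in visits s u.
Proof. by elim: u s => [|a u IHu] s; rewrite inE ?eqxx // [X in _ || X]IHu orbT. Qed.

Lemma mem_visits_cons s a u t :
  (t \in visits s (a :: u)) = (t == s) || (t \in visits (push s a) u).
Proof. by rewrite inE. Qed.

Lemma mem_visits_cat s u v t :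
  (t \in visits s (u ++ v)) = (t \in visits s u) || (t \in visits (run s u) v).
Proof.
elim: u s => [|a u IHu] s /=; last by rewrite !mem_visits_cons IHu orbA.
by rewrite mem_seq1; case: eqP => // ->; rewrite mem_visits_start.
Qed.

Lemma mem_visits_inv s u : reduced s -> visits (run s u) (inv_word u) =i visits s u.
Proof.
elim: u s => // a u IHu s hs t.
rewrite inv_word_cons -cats1 mem_visits_cat IHu ?reduced_push // mem_visits_cons.
rewrite run_cons run_inv ?reduced_push //.
rewrite mem_visits_cons pushK // mem_seq1 orbA orbC; congr orb.
by apply: orb_idr => /eqP->; exact: mem_visits_start.
Qed.

(** The starting vertex is arbitrary so that the induction passes through
    concatenation, whose second factor starts where the first one ends. *)
Lemma vagner_run_visits u v : vagner u v ->
  forall s, reduced s -> run s u = run s v /\ visits s u =i visits s v.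
Proof.
elim=> {u v} [u|u v|u|u v _ IH|u v w _ IH1 _ IH2|u u' v v' _ IH1 _ IH2] s hs //.
- rewrite !run_cat run_inv //; split=> // t.
  by rewrite !mem_visits_cat mem_visits_inv // run_inv // !orbb.
- rewrite !run_cat !run_inv //; split=> // t.
  rewrite !mem_visits_cat ?run_inv // !mem_visits_inv //.
  by case: (t \in visits s u); case: (t \in visits s v).
- by have [-> h] := IH s hs; split.
- have [-> h1] := IH1 s hs; have [-> h2] := IH2 s hs; split=> // t.
  by rewrite h1 h2.
- have [e1 h1] := IH1 s hs; rewrite !run_cat e1.
  have [-> h2] := IH2 _ (reduced_run u' hs); split=> // t.
  by rewrite !mem_visits_cat e1 h1 h2.
Qed.

(** * Torsion-freeness of the free group *)

(** A word acts on vertices through its reduced form, which is the reverse of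
    the stack it builds from the root. *)
Lemma run_reduce s u : reduced s -> run s u = run s (rev (run [::] u)).
Proof.
move=> hs; elim/last_ind: u => // u a IHu; rewrite !run_rcons IHu.
have : reduced (run [::] u) by exact: reduced_run.
case: (run [::] u) => [|b t] _ //=; rewrite rev_cons run_rcons.
case: eqP => [->|_]; first by rewrite pushK // reduced_run.
by rewrite !rev_cons !run_rcons.
Qed.

Lemma run_nocancel s u : (if s is b :: _ then path nocancel b u else reduced u) ->
  run s u = catrev u s.
Proof.
elim: u s => [|a u IHu] [|b s] //= h; first exact: (IHu [:: a]).
by case/andP: h => /negPf ab h; rewrite ab (IHu (a :: _)).
Qed.

Lemma odd_run s u : odd (size (run s u)) = odd (size s) (+) odd (size u).
Proof.
elim: u s => [|a u IHu] s /=; first by rewrite addbF.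
rewrite IHu; case: s => [|b s] //=; case: ifP => _ /=;
  by case: (odd (size s)); case: (odd (size u)).
Qed.

(** The final size records how many letters cancelled: if at least [j] did,
    then the first [j] letters of [u] are the inverses of the top [j] letters
    of the stack. *)
Lemma run_short_cancel j s u : reduced u ->
  size (run s u) + j.*2 <= size s + size u ->
  take j s = map (@inv_letter X) (take j u).
Proof.
elim: u s j => [|a u IHu] [|b s] [|j] //= hu.
- by rewrite addn0 -[X in _ <= X]addn0 leq_add2l.
- rewrite -/(run [:: a] u) run_nocancel // catrevE size_cat size_rev /=.
  by rewrite addn1 add0n -[X in _ <= X]addn0 leq_add2l.
case: eqP => [ab|/eqP ab] h.
  have rs : reduced u by exact: path_sorted hu.
  rewrite ab inv_letterK; congr cons; apply: (IHu s j) => //.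
  by move: h; rewrite doubleS !addnS !addSn !ltnS.
move: h; rewrite -/(run _ _) run_nocancel //= catrevE size_cat size_rev /=.
lia.
Qed.

Lemma nth_run_short i b s u : reduced u ->
  size (run s u) + i.*2 < (size s + size u).-1 -> i < size u ->
  nth b s i = inv_letter (nth b u i).
Proof.
move=> hu h iu.
have hj : size (run s u) + i.+1.*2 <= size s + size u by rewrite doubleS; lia.
by rewrite -(nth_take b (leqnn i.+1)) (run_short_cancel hu hj) (nth_map b)
  ?nth_take // size_take; case: ifP; lia.
Qed.

(** Squaring lengthens a nontrivial reduced word.  The final size has the parity
    of twice the length of the word, hence is even; were it at most that length,
    the cancellation would reach the middle of the word.  There it would make
    the middle letter its own inverse (odd length), or the two middle letters
    inverse to each other (even length). *)
Lemma size_run_square t : reduced t -> t != [::] ->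
  size t < size (run t (rev t)).
Proof.
move=> ht t0; rewrite ltnNge; apply/negP => hs.
have tp : 0 < size t by rewrite lt0n size_eq0.
have hrt : reduced (rev t).
  by rewrite /reduced rev_sorted; apply: sub_sorted ht => a b; rewrite nocancel_sym.
have [b _] : {b : letter X | true} by case: t tp {t0 ht hs hrt} => // b; exists b.
(* the stack position of the middle letter, or of the one of the two middle
   letters that comes later in the word *)
pose i := (size t).-1./2.
have hp := odd_run t (rev t); rewrite size_rev addbb in hp.
have hi : nth b t i = inv_letter (nth b (rev t) i).
  by apply: nth_run_short; rewrite // ?size_rev; rewrite /i; lia.
have it : i < size t by rewrite /i; lia.
rewrite nth_rev // in hi.
have [odd_t|even_t] := boolP (odd (size t)).
  have e : size t - i.+1 = i by rewrite /i; lia.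
  by move: hi; rewrite e => /eqP; rewrite (negPf (inv_letter_neq _)).
have e : size t - i.+1 = i.+1 by rewrite /i; lia.
move/(sortedP b): (ht) => /(_ i); rewrite /nocancel hi e.
rewrite inv_letterK eqxx => absurd.
by suff : ~~ true by []; apply: absurd; rewrite /i; lia.
Qed.

(** The powers of exponent [2 ^ k] of a nontrivial element are obtained by
    repeated squaring, so their lengths strictly increase with [k]. *)
Lemma run_torsion_free B t :
  (forall n, size (run [::] (flatten (nseq n t))) <= B) -> run [::] t = [::].
Proof.
move=> bounded; apply/eqP; case: eqP => // /eqP t0.
pose g k := run [::] (flatten (nseq (2 ^ k) t)).
have gS k : g k.+1 = run (g k) (rev (g k)).
  by rewrite /g expnS mul2n -addnn nseqD flatten_cat run_cat run_reduce ?reduced_run.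
have size_g k : k < size (g k).
  elim: k => [|k IHk]; first by rewrite /g /= cats0 lt0n size_eq0.
  rewrite gS (leq_ltn_trans IHk) // size_run_square ?reduced_run //.
  by rewrite -size_eq0 -lt0n (leq_ltn_trans _ IHk).
by have := leq_trans (size_g B) (bounded _); rewrite ltnn.
Qed.

End Stacks.

(** * Idempotents of the free inverse monoid *)

Section Idempotents.
Variable X : choiceType.
Notation A := (letter X).
Implicit Types (a b c : A) (u v w x : seq A).

Lemma fim_pi_cat u v : fim_pi (u ++ v) = (fim_pi u * fim_pi v)%g.
Proof. exact: fim_piM. Qed.

Lemma fim_pi_cons a u v : fim_pi u = fim_pi v -> fim_pi (a :: u) = fim_pi (a :: v).
Proof. by rewrite -cat1s -[a :: v]cat1s !fim_pi_cat => ->. Qed.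

Lemma fim_pi_catr u v w : fim_pi u = fim_pi v -> fim_pi (u ++ w) = fim_pi (v ++ w).
Proof. by rewrite !fim_pi_cat => ->. Qed.

Lemma fim_pi_catl u v w : fim_pi u = fim_pi v -> fim_pi (w ++ u) = fim_pi (w ++ v).
Proof. by rewrite !fim_pi_cat => ->. Qed.

Lemma fim_pi_inv u : fim_pi (u ++ inv_word u ++ u) = fim_pi u.
Proof. exact/fim_piP/vagner_inv. Qed.

(** These words represent idempotents; the form [x x^-1] is the one in which the
    commutation relation of the presentation applies. *)
Definition idempotent_word u := exists x, fim_pi u = fim_pi (x ++ inv_word x).

Lemma idempotent_wordC u v : idempotent_word u -> idempotent_word v ->
  fim_pi (u ++ v) = fim_pi (v ++ u).
Proof.
move=> [x ux] [y vy]; rewrite !fim_pi_cat ux vy -!fim_pi_cat -!catA.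
exact/fim_piP/vagner_comm.
Qed.

Lemma idempotent_word_range x : idempotent_word (x ++ inv_word x).
Proof. by exists x. Qed.

Lemma idempotent_word_nil : idempotent_word [::].
Proof. by exists [::]. Qed.

Lemma idempotent_word_conj c u :
  idempotent_word u -> idempotent_word (c :: u ++ [:: inv_letter c]).
Proof.
move=> [x ux]; exists (c :: x).
rewrite inv_word_cons -cats1 -cat1s -[(c :: x)]cat1s -!catA [x ++ _]catA.
by rewrite !fim_pi_cat ux !fim_pi_cat.
Qed.

Lemma idempotent_word_cat u v :
  idempotent_word u -> idempotent_word v -> idempotent_word (u ++ v).
Proof.
move=> [x ux] [y vy].
(* with p = x x^-1 and q = y y^-1 commuting idempotents, (p y) (p y)^-1 = p q p = p q *)
exists (x ++ inv_word x ++ y).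
rewrite !inv_word_cat inv_wordK.
have := idempotent_wordC (idempotent_word_range y) (idempotent_word_range x).
have := fim_pi_inv x; rewrite !fim_pi_cat ux vy !fim_pi_cat.
move: (fim_pi x) (fim_pi (inv_word x)) (fim_pi y) (fim_pi (inv_word y)).
move=> p p' q q' pp'p comm.
by rewrite -!mulgA (mulgA q q') comm !mulgA -(mulgA p p' p) pp'p.
Qed.

End Idempotents.

(** * Depth-first words *)

Section Tours.
Variables (X : finType) (le : rel (letter X)).
Notation A := (letter X).
Implicit Types (a b c : A) (s t u v w x : seq A) (F G : {set A}).

(** The letters that may follow [c] in a reduced word. *)
Definition away c : {set A} := [set~ inv_letter c].
Definition above F c : {set A} := [set b in F | (b != c) && le c b].

(** [F] is the set of letters allowed for the branches at the starting vertex.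
    It shrinks to the letters above [c] once the branch [c] has been explored,
    which forces the branches to come in increasing order. *)
Inductive tour : {set A} -> seq A -> Prop :=
| tour_nil F : tour F [::]
| tour_node F c u v : c \in F -> tour (away c) u -> tour (above F c) v ->
    tour F (c :: u ++ inv_letter c :: v).

(** The excursion at a vertex of the geodesic omits the branch [c] through which
    the geodesic leaves. *)
Inductive walk : {set A} -> seq A -> Prop :=
| walk_tour F w : tour F w -> walk F w
| walk_step F c u v : c \in F -> tour (F :\ c) u -> walk (away c) v ->
    walk F (u ++ c :: v).

Lemma above_sub F G c : F \subset G -> above F c \subset above G c.
Proof. by move=> FG; apply/subsetP => b; rewrite !inE => /andP[/(subsetP FG)-> ->]. Qed.

Lemma tour_sub F G w : F \subset G -> tour F w -> tour G w.
Proof.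
move=> FG tw; elim: tw G FG => {F w} [F|F c u v cF tu _ _ IHv] G FG; first by constructor.
by constructor; [exact: (subsetP FG) | | exact/IHv/above_sub].
Qed.

Lemma tour_idempotent F w : tour F w -> idempotent_word w.
Proof.
elim=> {F w} [F|F c u v _ _ IHu _ IHv]; first exact: idempotent_word_nil.
rewrite -cat1s [u ++ _](catA u [:: _]) catA; apply: idempotent_word_cat IHv.
exact: idempotent_word_conj.
Qed.

(** * Reduction to normal form *)

Section Normalisation.
Hypothesis hle : total_order le.

(** When the walk backtracks along the last geodesic edge [c], the branch behind
    [c] becomes part of the excursion [u] and has to move left to its sorted
    place.  The word it jumps over is an idempotent, so the element is unchanged,
    and lexicographically the result is no larger: where the words first differ,
    [c] takes the place of a larger letter. *)
Lemma tour_insert F c u v : c \in F -> tour (F :\ c) u -> tour (away c) v ->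
  let w := u ++ c :: v ++ [:: inv_letter c] in
  exists2 u', tour F u' & fim_pi u' = fim_pi w /\ shortlex le u' w.
Proof.
have [_ _ trans total] := hle.
move=> cF tu tv; move: {1 3}(F :\ c) (subxx (F :\ c)) tu => G sub tu.
have cv : idempotent_word (c :: v ++ [:: inv_letter c]).
  exact/idempotent_word_conj/tour_idempotent/tv.
elim: tu F cF sub => {G u} [G|G d u1 u2 dG tu1 _ tu2 IH] F cF sub /=.
  exists (c :: v ++ [:: inv_letter c]); last by split; rewrite ?shortlex_refl.
  by constructor => //; constructor.
have [dc dF] : d != c /\ d \in F by have := subsetP sub d dG; rewrite !inE => /andP.
have [le_dc|le_cd] := orP (total d c).
  have [||u' tu' [pi_u' le_u']] := IH (above F d).
  - by rewrite inE cF eq_sym dc.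
  - apply/subsetP => b; rewrite !inE => /and3P[bG -> ->].
    by have := subsetP sub b bG; rewrite !inE => /andP[-> ->].
  exists (d :: u1 ++ inv_letter d :: u'); first by constructor.
  rewrite -catA shortlex_cons shortlex_catl shortlex_cons; split=> //.
  exact/fim_pi_cons/fim_pi_catl/fim_pi_cons.
exists (c :: v ++ inv_letter c :: d :: u1 ++ inv_letter d :: u2).
  constructor=> //; constructor=> //; first by rewrite inE dF dc.
  apply: tour_sub tu2; apply/subsetP => b; rewrite !inE => /and3P[bG bd le_db].
  have := subsetP sub b bG; rewrite !inE => /andP[-> ->].
  by rewrite bd le_db (trans d).
set x := d :: _; have ix : idempotent_word x.
  by apply: (@tour_idempotent G); constructor.
split; first by rewrite (idempotent_wordC ix cv) /= -catA.
rewrite /shortlex /= (eq_sym c) (negPf dc) le_cd orbC.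
by rewrite !size_cat /= !size_cat /=; apply/orP; left; lia.
Qed.

(** When the walk leaves along [c], a branch [c] already explored by the excursion
    [w] must be taken out and explored after crossing [c] instead.  This saves
    two crossings of that edge, so the word becomes shorter. *)
Lemma tour_extract F c w : c \in F -> tour F w ->
  exists u v, [/\ tour (F :\ c) u, tour (away c) v &
    fim_pi (u ++ c :: v) = fim_pi (rcons w c) /\
    shortlex le (u ++ c :: v) (rcons w c)].
Proof.
have [_ anti trans total] := hle.
move=> cF tw; elim: tw cF => {F w} [F|F d u v dF tu _ tv IH] cF.
  by exists [::], [::]; split; [constructor|constructor|rewrite shortlex_refl].
have [dc|dc] := eqVneq d c.
  subst d; exists v, u; split=> //.
    by apply: tour_sub tv; apply/subsetP => b; rewrite !inE => /and3P[-> -> _].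
  split; last by apply: shortlex_of_size; rewrite size_rcons !size_cat /= !size_cat /=; lia.
  (* (c u c^-1) v c = v (c u c^-1) c = v c (c^-1 c) u = v c u *)
  have iu := tour_idempotent tu; have iv := tour_idempotent tv.
  have icc : idempotent_word [:: inv_letter c; c].
    by exists [:: inv_letter c]; rewrite /inv_word /= inv_letterK.
  have moved := fim_pi_catr [:: c] (idempotent_wordC (idempotent_word_conj c iu) iv).
  rewrite /= -!catA /= -!catA /= in moved.
  rewrite /= rcons_cat /= -cats1 moved; apply: fim_pi_catl.
  rewrite (fim_pi_cons c (idempotent_wordC iu icc)).
  exact/esym/(fim_pi_catr u (fim_pi_inv [:: c])).
have [le_dc|le_cd] := orP (total d c).
  have [|u' [v' [tu' tv' [pi_u' le_u']]]] := IH; first by rewrite inE cF eq_sym dc.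
  exists (d :: u ++ inv_letter d :: u'), v'; split=> //.
    constructor=> //; first by rewrite !inE dc.
    by apply: tour_sub tu'; apply/subsetP => b; rewrite !inE => /and4P[-> -> -> ->].
  rewrite /= rcons_cat -catA shortlex_cons shortlex_catl shortlex_cons; split=> //.
  exact/fim_pi_cons/fim_pi_catl/fim_pi_cons.
exists (d :: u ++ inv_letter d :: v), [::]; split; [|by constructor|by rewrite cats1 shortlex_refl].
constructor=> //; first by rewrite !inE dc.
apply: tour_sub tv; apply/subsetP => b; rewrite !inE => /and3P[-> bd le_db].
rewrite bd le_db !andbT; apply: contraNneq bd => bc; subst b.
by apply/eqP/anti; rewrite le_cd.
Qed.

(** The second alternative is a walk that stays at its starting vertex and then
    leaves through a forbidden letter; one level up this letter is the inverse
    of the edge just crossed, so [tour_insert] applies. *)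
Lemma walk_rcons F w c : walk F w ->
  (exists2 w', walk F w' &
     fim_pi w' = fim_pi (rcons w c) /\ shortlex le w' (rcons w c)) \/
  (tour F w /\ c \notin F).
Proof.
elim=> {F w} [F w tw|F d u v dF tu wv IH].
  have [cF|cF] := boolP (c \in F); last by right.
  have [u [v [tu tv ?]]] := tour_extract cF tw.
  by left; exists (u ++ c :: v) => //; apply: walk_step => //; exact: walk_tour.
left; case: IH => [[w' ww' [pi_w' le_w']]|[tv]].
  exists (u ++ d :: w'); first exact: walk_step.
  rewrite rcons_cat rcons_cons shortlex_catl shortlex_cons; split=> //.
  exact/fim_pi_catl/fim_pi_cons.
rewrite !inE negbK => /eqP->; rewrite rcons_cat rcons_cons -cats1.
by have [u' tu' ?] := tour_insert dF tu tv; exists u' => //; exact: walk_tour.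
Qed.

Lemma ex_normal_form w :
  exists2 w', walk [set: A] w' & fim_pi w' = fim_pi w /\ shortlex le w' w.
Proof.
elim/last_ind: w => [|w c [u wu [pi_u le_u]]].
  by exists [::]; [do 2!constructor | rewrite shortlex_refl].
have [[u' wu' [pi_u' le_u']]|[_]] := walk_rcons c wu; last by rewrite inE.
exists u' => //; split; first by rewrite pi_u' -!cats1 !fim_pi_cat pi_u.
by apply: shortlex_trans le_u' _; rewrite -?cats1 ?shortlex_catr.
Qed.

End Normalisation.

(** * Uniqueness of normal forms *)

(** From the vertex [s], all letters of [F] lead away from the root. *)
Definition fresh s F := forall c, c \in F -> push s c = c :: s.

Lemma fresh_nil F : fresh [::] F.
Proof. by []. Qed.

Lemma fresh_away c s : fresh (c :: s) (away c).
Proof. by move=> d; rewrite !inE /= => /negPf->. Qed.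

Lemma fresh_sub s F G : F \subset G -> fresh s G -> fresh s F.
Proof. by move=> /subsetP FG hG c /FG/hG. Qed.

Lemma above_subset F c : above F c \subset F.
Proof. by apply/subsetP => b; rewrite inE => /andP[]. Qed.

Lemma push_pop c s : push (c :: s) (inv_letter c) = s.
Proof. by rewrite /= eqxx. Qed.

Lemma run_tour F w s : tour F w -> fresh s F -> run s w = s.
Proof.
move=> tw; elim: tw s => {F w} // F c u v cF _ IHu _ IHv s sF.
rewrite run_cons run_cat sF // IHu; last exact: fresh_away.
rewrite run_cons push_pop IHv //.
exact: fresh_sub (above_subset F c) sF.
Qed.

Lemma mem_visits_node F c u v s t : c \in F -> tour (away c) u -> fresh s F ->
  (t \in visits s (c :: u ++ inv_letter c :: v)) =
  [|| t \in visits (c :: s) u | t \in visits s v].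
Proof.
move=> cF tu sF; rewrite mem_visits_cons sF // mem_visits_cat.
rewrite (run_tour tu) ?mem_visits_cons ?push_pop; last exact: fresh_away.
have [->|_] := eqVneq t (c :: s); first by rewrite mem_visits_start !orbT.
by have [->|_] := eqVneq t s; rewrite //= mem_visits_start !orbT.
Qed.

Lemma suffix_consl c s t : suffix (c :: s) t -> suffix s t.
Proof. by case/suffixP => x ->; rewrite -cat_rcons suffix_suffix. Qed.

Lemma suffix_cons_inj c d s t : suffix (c :: s) t -> suffix (d :: s) t -> c = d.
Proof.
case/suffixP => x -> /suffixP[y] /(congr1 rev); rewrite !rev_cat !rev_cons.
rewrite -!cats1 -!catA => /eqP; rewrite eqseq_cat // eqxx /= => /eqP.
by case.
Qed.

Lemma suffix_cons_self c s : suffix (c :: s) s = false.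
Proof. by apply/negP => /size_suffix; rewrite ltnn. Qed.

Lemma cons_neq_self c s : (c :: s == s) = false.
Proof. by apply/eqP => /(congr1 size) /= /esym/n_Sn. Qed.

Lemma visits_tour F w s t : tour F w -> fresh s F -> t \in visits s w ->
  t = s \/ exists2 c, c \in F & suffix (c :: s) t.
Proof.
move=> tw; elim: tw s => {F w} [F|F c u v cF tu IHu tv IHv] s sF.
  by rewrite mem_seq1 => /eqP; left.
have vF : fresh s (above F c) by apply: fresh_sub sF; exact: above_subset.
rewrite (@mem_visits_node F) // => /orP[/(IHu _ (@fresh_away c s))|/(IHv _ vF)].
  case=> [->|[d _ /suffix_consl]]; last by right; exists c.
  by right; exists c; rewrite ?suffix_refl.
case=> [->|[d dF]]; [by left|right; exists d => //].
exact: subsetP (above_subset F c) _ dF.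
Qed.

Lemma visits_walk F w s t : walk F w -> fresh s F -> t \in visits s w -> suffix s t.
Proof.
move=> ww; elim: ww s => {F w} [F w tw|F c u v cF tu wv IH] s sF.
  by case/(visits_tour tw sF)=> [->|[c _ /suffix_consl]]; rewrite ?suffix_refl.
have uF : fresh s (F :\ c) by apply: fresh_sub sF; exact: subD1set.
rewrite mem_visits_cat mem_visits_cons (run_tour tu) // sF //.
case/or3P=> [/(visits_tour tu uF)|/eqP->|/(IH _ (@fresh_away c s))/suffix_consl //].
  by case=> [->|[d _ /suffix_consl]]; rewrite ?suffix_refl.
exact: suffix_refl.
Qed.

Lemma visits_avoid F w s c t : tour F w -> fresh s F -> c \notin F ->
  t \in visits s w -> suffix (c :: s) t = false.
Proof.
move=> tw sF cF /(visits_tour tw sF)[->|[d dF dt]]; first exact: suffix_cons_self.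
by apply: contraNF cF => /suffix_cons_inj/(_ dt)->.
Qed.

(** Visits inside the branch behind a given edge ([P], [P']) and outside of it
    ([Q], [Q']) can be told apart, so equality of the unions is equality of the
    parts.  This is what makes the two inductions below work. *)
Lemma visits_split (P Q P' Q' : seq (seq A)) (B : pred (seq A)) :
    {in P, forall t, B t} -> {in P', forall t, B t} ->
    {in Q, forall t, B t = false} -> {in Q', forall t, B t = false} ->
    (forall t, (t \in P) || (t \in Q) = (t \in P') || (t \in Q')) ->
  P =i P' /\ Q =i Q'.
Proof.
move=> hP hP' hQ hQ' e; split=> t; move: (hP t) (hP' t) (hQ t) (hQ' t) (e t).
all: case: (t \in P); case: (t \in P'); case: (t \in Q); case: (t \in Q') => //.
all: by case: (B t) => h1 h2 h3 h4 //; first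
  [by move: (h1 isT) | by move: (h2 isT) | by move: (h3 isT) | by move: (h4 isT)].
Qed.

Hypothesis hle : total_order le.

(** The first branch of a tour is the least child of [s] that is visited, hence
    is determined by the visited set.  Then [visits_split] separates the visits
    in this branch from those of the remaining tour. *)
Lemma tour_inj F w w' s : tour F w -> tour F w' -> fresh s F ->
  visits s w =i visits s w' -> w = w'.
Proof.
have [_ anti _ _] := hle.
(* a visited child of the start is the first branch or lies above it *)
have root G c x s1 : c \in G -> tour G x -> fresh s1 G -> c :: s1 \in visits s1 x ->
    exists d u v, [/\ x = d :: u ++ inv_letter d :: v, tour (away d) u,
      tour (above G d) v, d \in G & c = d \/ c \in above G d].
  move=> cG tx; case: tx cG => {G x} [G|G d u v dG tu tv] cG sG.
    by rewrite mem_seq1 cons_neq_self.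
  rewrite (@mem_visits_node G) // => /orP[du|dv]; exists d, u, v; split=> //.
    left; apply: (@suffix_cons_inj c d s1 (c :: s1)); first exact: suffix_refl.
    exact: visits_walk (walk_tour tu) (@fresh_away d s1) du.
  have vG : fresh s1 (above G d) by apply: fresh_sub sG; exact: above_subset.
  right; case/(visits_tour tv vG): dv => [/eqP|[b bG]].
    by rewrite cons_neq_self.
  by move/(@suffix_cons_inj c b s1 _ (suffix_refl _))->.
move=> tw; elim: tw w' s => {F w} [F|F c u v cF tu IHu tv IHv] w' s tw' sF eqv.
  case: tw' sF eqv => // G c u v cG tu tv sG /(_ (c :: s)).
  by rewrite mem_seq1 cons_neq_self (@mem_visits_node G) // mem_visits_start.
have [|d [u' [v' [ew' tu' tv' dF cd]]]] := root F c w' s cF tw' sF.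
  by rewrite -eqv (@mem_visits_node F) // mem_visits_start.
have dc : d = c \/ d \in above F c.
  have [|b [x [y [[<- _] _ _ _ //]]]] := root F d _ s dF (tour_node cF tu tv) sF.
  by rewrite eqv ew' (@mem_visits_node F) // mem_visits_start.
have {cd dc} cd : c = d.
  case: cd dc => [//|+ [//|]]; rewrite !inE => /and3P[_ _ le_dc] /and3P[_ _ le_cd].
  by apply: anti; rewrite le_cd.
subst d w'; move: eqv.
have vF : fresh s (above F c) by apply: fresh_sub sF; exact: above_subset.
have below x : tour (away c) x -> {in visits (c :: s) x, forall t, suffix (c :: s) t}.
  by move=> tx t; exact: visits_walk (walk_tour tx) (@fresh_away c s).
have beside x : tour (above F c) x -> {in visits s x, forall t, suffix (c :: s) t = false}.
  by move=> tx t; apply: visits_avoid tx vF _; rewrite !inE eqxx andbF.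
move=> eqv; have [|equ eqv'] := visits_split (below u tu) (below u' tu') (beside v tv) (beside v' tv').
  by move=> t; move: (eqv t); rewrite !(@mem_visits_node F).
by rewrite (IHu u' _ tu' (@fresh_away c s) equ) (IHv v' s tv' vF eqv').
Qed.

(** The endpoint lies strictly below [s] exactly when the walk crosses a geodesic
    edge, and then determines that edge; [visits_split] separates the vertices
    behind it from those of the excursion made before crossing it. *)
Lemma walk_inj F w w' s : walk F w -> walk F w' -> fresh s F ->
  run s w = run s w' -> visits s w =i visits s w' -> w = w'.
Proof.
have below_run c x s1 : walk (away c) x -> suffix (c :: s1) (run (c :: s1) x).
  by move=> wx; exact: visits_walk wx (@fresh_away c s1) (mem_visits_end _ _).
have sub c G : G :\ c \subset G by exact: subD1set.
have run_step G c u v s1 : c \in G -> tour (G :\ c) u -> fresh s1 G ->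
    run s1 (u ++ c :: v) = run (c :: s1) v.
  by move=> cG tu sG; rewrite run_cat run_cons (run_tour tu (fresh_sub (sub c G) sG)) sG.
move=> ww; elim: ww w' s => {F w} [F w tw|F c u v cF tu wv IH] w' s ww' sF.
  case: ww' tw sF => {F w'} [F w' tw' tw sF _|F c u v cF tu wv tw sF].
    exact: tour_inj tw tw' sF.
  rewrite (run_tour tw sF) (run_step F) // => e.
  by have := below_run c v s wv; rewrite -e suffix_cons_self.
rewrite (run_step F) //; case: ww' cF tu sF => {F w'} [F w' tw'|F d u' v' dF tu' wv'] cF tu sF.
  rewrite (run_tour tw' sF) // => e.
  by have := below_run c v s wv; rewrite e suffix_cons_self.
rewrite (run_step F) // => e; have cd : c = d.
  by apply: suffix_cons_inj (below_run c v s wv) _; rewrite e below_run.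
subst d => eqv; have uF := fresh_sub (sub c F) sF.
have below x : walk (away c) x -> {in visits (c :: s) x, forall t, suffix (c :: s) t}.
  by move=> wx t; exact: visits_walk wx (@fresh_away c s).
have beside x : tour (F :\ c) x -> {in visits s x, forall t, suffix (c :: s) t = false}.
  by move=> tx t; apply: visits_avoid tx uF _; rewrite !inE eqxx.
have visits_step x y t : tour (F :\ c) x ->
    (t \in visits s (x ++ c :: y)) = (t \in visits (c :: s) y) || (t \in visits s x).
  move=> tx; rewrite mem_visits_cat mem_visits_cons (run_tour tx uF) sF // orbCA orbA.
  rewrite orbC; congr orb; apply: orb_idl => /eqP->; exact: mem_visits_start.
have [t|eqv' equ] := visits_split (below v wv) (below v' wv') (beside u tu) (beside u' tu').
  by rewrite -!visits_step.
by rewrite (tour_inj tu tu' uF equ) (IH v' _ wv' (@fresh_away c s) e eqv').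
Qed.

(** * Shortlex normal forms and Green's relation H *)

(** Munn's theorem: both words reduce to the same normal form. *)
Lemma munn u v : run [::] u = run [::] v -> visits [::] u =i visits [::] v ->
  fim_pi u = fim_pi v.
Proof.
move=> euv vuv.
have [u' wu' [pi_u _]] := ex_normal_form hle u.
have [v' wv' [pi_v _]] := ex_normal_form hle v.
have [eu vu] := vagner_run_visits (proj1 (fim_piP _ _) pi_u) (isT : reduced [::]).
have [ev vv] := vagner_run_visits (proj1 (fim_piP _ _) pi_v) (isT : reduced [::]).
rewrite -pi_u -pi_v (walk_inj wu' wv' (@fresh_nil _)) ?eu ?ev //.
by move=> t; rewrite vu vv vuv.
Qed.

(** A minimal word coincides with its normal form, which is not larger.
    Conversely a walk [w] is the normal form of every word [u] equivalent to it,
    so [w] is not larger than [u]. *)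
Lemma SL_FIM_walk w : SL_FIM le w <-> walk [set: A] w.
Proof.
split=> [[_ min_w]|ww].
  by have [u wu [pi_u le_u]] := ex_normal_form hle w; rewrite -(min_w u).
split=> //= u pi_u le_u; have [v wv [pi_v le_v]] := ex_normal_form hle u.
have pi_vw : fim_pi v = fim_pi w by rewrite pi_v.
have [e ev] := vagner_run_visits (proj1 (fim_piP _ _) pi_vw) (isT : reduced [::]).
have vw := walk_inj wv ww (@fresh_nil _) e ev; subst v.
exact: shortlex_anti hle _ _ le_u le_v.
Qed.

(** Multiplication on the right can only add visited vertices, and each of the
    two elements is a right multiple of the other. *)
Lemma greenR_visits u v : greenR (fim_pi u) (fim_pi v) ->
  forall s, reduced s -> visits s u =i visits s v.
Proof.
have sub x y : greenR (fim_pi x) (fim_pi y) ->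
    forall s, reduced s -> {subset visits s y <= visits s x}.
  move=> xy s hs t ty.
  have : range (fun p => fim_pi x * p)%g (fim_pi x) by exists 1%g; rewrite ?mulg1.
  rewrite xy => -[p _ yp]; have [z zp] := fim_pi_surj p.
  have /fim_piP/vagner_run_visits/(_ s hs)[_ e] : fim_pi (y ++ z) = fim_pi x.
    by rewrite fim_pi_cat zp.
  by rewrite -e mem_visits_cat ty.
by move=> uv s hs t; apply/idP/idP; apply: sub => //; exact: esym.
Qed.

Lemma greenH_trivial u v : greenH (fim_pi u) (fim_pi v) -> fim_pi u = fim_pi v.
Proof.
case=> uLv uRv; have eqv := greenR_visits uRv.
have : range (fun p => p * fim_pi v)%g (fim_pi u).
  by rewrite -uLv; exists 1%g; rewrite ?mul1g.
case=> p _ pv; have [t tp] := fim_pi_surj p.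
have [e et] : (forall s, reduced s -> run s (t ++ v) = run s u) /\
    (forall s, reduced s -> visits s (t ++ v) =i visits s u).
  have /fim_piP/vagner_run_visits tvu : fim_pi (t ++ v) = fim_pi u by rewrite fim_pi_cat tp.
  by split=> s /tvu[].
(* the powers of t map the tree of u, which is also that of v, into itself *)
have orbit n : {subset visits (run [::] (flatten (nseq n t))) u <= visits [::] u}.
  elim: n => // n IH r ru; apply: IH.
  have hr : reduced (run [::] (flatten (nseq n t))) by exact: reduced_run.
  rewrite -et // mem_visits_cat -eqv ?reduced_run //; apply/orP; right.
  by move: ru; rewrite -addn1 nseqD flatten_cat run_cat /= cats0.
have t1 : run [::] t = [::].
  apply: (@run_torsion_free _ (\max_(r <- visits [::] u) size r)) => n.
  rewrite (leq_bigmax_seq (F := size)) //; exact/orbit/mem_visits_start.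
by apply: munn; [rewrite -e // run_cat t1 | exact: eqv].
Qed.

End Tours.

(** * The grammar *)

Section ContextFreeGrammars.
Variables (A : eqType) (G : cfg A).
Notation N := (nonterm G).
Implicit Types (l r s : seq (N + A)) (w x : seq A).

Lemma derives_trans s1 s2 s3 : derives s1 s2 -> derives s2 s3 -> derives s1 s3.
Proof.
by move=> d12 d23; elim: d23 d12 => // s l n rhs r nr _ IH /IH; exact: derives_step.
Qed.

Lemma derives_ctx l r s1 s2 : derives s1 s2 -> derives (l ++ s1 ++ r) (l ++ s2 ++ r).
Proof.
elim=> {s1 s2} [s|s l' n rhs r' nr _ IH]; first exact: derives_refl.
rewrite -!catA [l ++ l' ++ _]catA; apply: derives_step nr _.
by move: IH; rewrite -!catA [l ++ l' ++ _]catA.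
Qed.

Lemma derives_cat s1 s2 r1 r2 :
  derives s1 r1 -> derives s2 r2 -> derives (s1 ++ s2) (r1 ++ r2).
Proof.
move=> d1 d2; apply: (@derives_trans _ (r1 ++ s2)).
  exact: (derives_ctx [::]).
by have := derives_ctx r1 [::] d2; rewrite !cats0.
Qed.

Lemma derives_cons b s1 s2 : derives s1 s2 -> derives (b :: s1) (b :: s2).
Proof. exact: (derives_cat (derives_refl [:: b])). Qed.

Lemma derives_rule n rhs s :
  (n, rhs) \in rules G -> derives rhs s -> derives [:: inl n] s.
Proof.
move=> nr; apply: derives_trans; rewrite -[rhs]cats0.
by apply: (derives_step (l := [::]) nr); exact: derives_refl.
Qed.

(** If every production is valid for a family [lang] of languages indexed by the
    nonterminals, then the words derived from a nonterminal lie in its language.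
    To prove it, [lang] is extended to sentential forms ([yields]), and validity
    lets membership travel backwards along a derivation. *)
Variable lang : N -> seq A -> Prop.

Fixpoint yields s w : Prop :=
  match s with
  | [::] => w = [::]
  | inr a :: s' => exists2 w', w = a :: w' & yields s' w'
  | inl n :: s' => exists x w', [/\ w = x ++ w', lang n x & yields s' w']
  end.

Lemma yields_cat s1 s2 w :
  yields (s1 ++ s2) w <-> exists w1 w2, [/\ w = w1 ++ w2, yields s1 w1 & yields s2 w2].
Proof.
elim: s1 w => [|[n|a] s1 IH] w /=; split.
- by exists [::], w.
- by case=> _ [w2 [-> -> ?]].
- case=> x [_ [-> nx /IH[w1 [w2 [-> y1 y2]]]]].
  by exists (x ++ w1), w2; split=> //; [rewrite catA | exists x, w1].
- case=> _ [w2 [-> [x [w1 [-> nx y1]]] y2]]; rewrite -catA.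
  by exists x, (w1 ++ w2); split=> //; apply/IH; exists w1, w2.
- case=> _ -> /IH[w1 [w2 [-> y1 y2]]].
  by exists (a :: w1), w2; split=> //; exists w1.
- case=> _ [w2 [-> [w1 -> y1] y2]].
  by exists (w1 ++ w2) => //; apply/IH; exists w1, w2.
Qed.

Lemma yields_terminals w : yields (map inr w) w.
Proof. by elim: w => //= a w IHw; exists w. Qed.

Lemma derives_lang n w :
  (forall m rhs, (m, rhs) \in rules G -> forall x, yields rhs x -> lang m x) ->
  derives [:: inl n] (map inr w) -> lang n w.
Proof.
move=> sound nw.
have back s1 s2 : derives s1 s2 -> forall x, yields s2 x -> yields s1 x.
  elim=> {s1 s2} // s l m rhs r mr _ IH x /yields_cat[w1 [w' [-> y1]]].
  case/yields_cat=> w2 [w3 [{w'}-> y2 y3]]; apply/IH/yields_cat.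
  exists w1, (w2 ++ w3); split=> //=; exists w2, w3; split=> //.
  exact: sound mr _ y2.
have /= := back _ _ nw _ (yields_terminals w).
by case=> x [_ [-> nx ->]]; rewrite cats0.
Qed.

End ContextFreeGrammars.

Section WalkGrammar.
Variables (X : finType) (le : rel (letter X)).
Notation A := (letter X).
Notation N := (bool * {set A})%type.
Implicit Types (F : {set A}) (c : A) (w : seq A).

(** The nonterminals [(false, F)] and [(true, F)] stand for [tour F] and [walk F],
    and there is one production for each constructor of these predicates. *)
Definition tour_rules F : seq (N * seq (N + A)) :=
  ((false, F), [::]) ::
  [seq ((false, F), [:: inr c; inl (false, away c); inr (inv_letter c);
                        inl (false, above le F c)]) | c <- enum F].

Definition walk_rules F : seq (N * seq (N + A)) :=
  ((true, F), [:: inl (false, F)]) ::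
  [seq ((true, F), [:: inl (false, F :\ c); inr c; inl (true, away c)]) | c <- enum F].

Definition walk_cfg : cfg A :=
  CFG (true, [set: A])
    (flatten [seq tour_rules F ++ walk_rules F | F <- enum {set A}]).

Definition walk_lang (n : N) w : Prop := if n.1 then walk le n.2 w else tour le n.2 w.

Lemma mem_walk_cfg F p :
  p \in tour_rules F ++ walk_rules F -> p \in rules walk_cfg.
Proof.
move=> pF; apply/flatten_mapP; exists F => //; exact: mem_enum.
Qed.

Lemma walk_cfg_sound n rhs : (n, rhs) \in rules walk_cfg ->
  forall w, yields (G := walk_cfg) walk_lang rhs w -> walk_lang n w.
Proof.
case/flatten_mapP=> F _; rewrite mem_cat => /orP[]; rewrite inE => /orP[].
- by case/eqP=> -> -> w /= ->; exact: tour_nil.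
- case/mapP=> c; rewrite mem_enum => cF [-> ->] w /=.
  case=> _ -> [u [_ [-> tu [_ -> [v [_ [-> tv ->]]]]]]]; rewrite cats0.
  exact: tour_node.
- by case/eqP=> -> -> w /= [u [_ [-> tu ->]]]; rewrite cats0; exact: walk_tour.
- case/mapP=> c; rewrite mem_enum => cF [-> ->] w /=.
  case=> u [_ [-> tu [_ -> [v [_ [-> wv ->]]]]]]; rewrite cats0.
  exact: walk_step.
Qed.

Lemma tour_derives F w :
  tour le F w -> derives (G := walk_cfg) [:: inl (false, F)] (map inr w).
Proof.
elim=> {F w} [F|F c u v cF _ IHu _ IHv].
  apply: (derives_rule (rhs := [::])); last exact: derives_refl.
  by apply: (@mem_walk_cfg F); rewrite inE eqxx.
apply: derives_rule.
  apply: (@mem_walk_cfg F); rewrite mem_cat; apply/orP; left; rewrite inE.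
  by apply/orP; right; apply/mapP; exists c; rewrite ?mem_enum.
rewrite /= map_cat; apply: derives_cons; apply: (derives_cat IHu).
exact: derives_cons.
Qed.

Lemma walk_derives F w :
  walk le F w -> derives (G := walk_cfg) [:: inl (true, F)] (map inr w).
Proof.
elim=> {F w} [F w tw|F c u v cF tu _ IHv].
  apply: derives_rule (tour_derives tw).
  by apply: (@mem_walk_cfg F); rewrite mem_cat !inE eqxx orbT.
apply: derives_rule.
  apply: (@mem_walk_cfg F); rewrite mem_cat; apply/orP; right; rewrite inE.
  by apply/orP; right; apply/mapP; exists c; rewrite ?mem_enum.
rewrite map_cat; apply: (derives_cat (tour_derives tu)).
exact: derives_cons.
Qed.

Lemma walk_cfg_language w : cfg_language walk_cfg w <-> walk le [set: A] w.
Proof.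
split; last exact: walk_derives.
exact: derives_lang (@walk_cfg_sound).
Qed.

End WalkGrammar.

Theorem theorem6p2 (X : finType) (le : rel (letter X)) (hle : total_order le) :
  H_SL_FIM le = SL_FIM le /\ context_free (SL_FIM le).
Proof.
split.
  apply/seteqP; split=> w [_ min_w]; split=> // u uw le_uw; apply: min_w => //.
    by rewrite /= uw.
  exact: greenH_trivial hle _ _ uw.
exists (walk_cfg le); apply/seteqP.
by split=> w; [move/walk_cfg_language/SL_FIM_walk; exact | move/SL_FIM_walk/walk_cfg_language; exact].
Qed.
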